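(* Let $n\ge 3$. For each $u\in PT_{n-1}$ (respectively $u\in T_{n-1}$), the system of equations $$d_0(w)=u,\quad d_1(w)=u,\quad \dots,\quad d_{n-1}(w)=u$$ has a solution $w\in PT_n$ (respectively $w\in T_n$) if and only if $u$ satisfies the condition $$d_0(u)=d_1(u)=\cdots=d_{n-2}(u).$$
   Context: For $n\ge 2$ the twin group $T_n$ is generated by $t_1,\dots,t_{n-1}$ with relations $t_i^2=1$ and $t_it_j=t_jt_i$ for $|i-j|\ge 2$; $T_1$ is trivial. Geometrically its elements (twins) are homotopy classes of configurations of $n$ monotone strands in $\mathbb R\times[0,1]$ joining $n$ marked points on $y=1$ to $n$ marked points on $y=0$, with no three strands through a common point; the product is stacking (left factor on top), and $t_i$ is the single crossing of the strands in positions $i,i+1$. For $u\in T_n$ let $\nu(u)\in S_n$ be the permutation such that the strand of $u$ starting at position $k$ ends at position $\nu(u)(k)$. The pure twin group $PT_n$ is the subgroup of all $u$ with $\nu(u)=1$. For $0\le i\le n-1$ the map $d_i:T_n\to T_{n-1}$ deletes the strand starting at position $i+1$; it is determined by $d_i(uw)=d_i(u)\,d_{\nu(u)(i+1)-1}(w)$ together with $d_i(t_j)=t_{j-1}$ if $i+1<j$, $d_i(t_j)=1$ if $i+1\in\{j,j+1\}$, and $d_i(t_j)=t_j$ if $i+1>j+1$. It maps $PT_n$ into $PT_{n-1}$ and is a group homomorphism there. *)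

(* Defs.v *)
From HB Require Import structures.
From mathcomp Require Import all_boot all_fingroup.
From mathcomp Require Import boolp zify.

Set Implicit Arguments.
Unset Strict Implicit.
Unset Printing Implicit Defensive.

Local Open Scope group_scope.
Local Open Scope quotient_scope.

(* Everything is 0-based: the letter j : 'I_n.-1 stands for t_(j+1), which     *)
(* crosses the strands in positions j and j+1 of 'I_n. The generators being    *)
(* involutions, T_n is the monoid of words in them modulo the congruence       *)
(* below; T_0 and T_1 have no generator.                                       *)
Inductive twin_cong (n : nat) : seq 'I_n.-1 -> seq 'I_n.-1 -> Prop :=
| twin_cong_refl w : twin_cong w w
| twin_cong_sym v w : twin_cong v w -> twin_cong w v
| twin_cong_trans u v w : twin_cong u v -> twin_cong v w -> twin_cong u w
| twin_cong_sq x y j : twin_cong (x ++ [:: j; j] ++ y) (x ++ y)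
| twin_cong_comm x y (j k : 'I_n.-1) : (j.+1 < k)%N || (k.+1 < j)%N ->
    twin_cong (x ++ [:: j; k] ++ y) (x ++ [:: k; j] ++ y).

Definition twin_congb n : rel (seq 'I_n.-1) := fun v w => `[< twin_cong v w >].

Lemma twin_congb_refl n : reflexive (@twin_congb n).
Proof. by move=> w; apply/asboolP; apply: twin_cong_refl. Qed.

Lemma twin_congb_sym n : symmetric (@twin_congb n).
Proof. by move=> v w; apply/asboolP/asboolP; apply: twin_cong_sym. Qed.

Lemma twin_congb_trans n : transitive (@twin_congb n).
Proof.
move=> v u w /asboolP uv /asboolP vw; apply/asboolP.
exact: twin_cong_trans uv vw.
Qed.

Canonical twin_equiv n :=
  EquivRel (@twin_congb n) (@twin_congb_refl n) (@twin_congb_sym n)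
           (@twin_congb_trans n).

Definition twin (n : nat) := {eq_quot (twin_equiv n)}.
HB.instance Definition _ n := Choice.on (twin n).

Definition twin_of n (w : seq 'I_n.-1) : twin n := \pi_({eq_quot (twin_equiv n)}) w.
Definition word_of n (u : twin n) : seq 'I_n.-1 := generic_quotient.repr u.

Lemma word_ofK n : cancel (@word_of n) (@twin_of n).
Proof. exact: reprK. Qed.

Lemma twin_ofP n (v w : seq 'I_n.-1) : twin_of v = twin_of w <-> twin_cong v w.
Proof. by split=> [/eqmodP/asboolP | vw]; last exact/eqmodP/asboolP. Qed.

Lemma word_of_cong n (w : seq 'I_n.-1) : twin_cong (word_of (twin_of w)) w.
Proof. by apply/twin_ofP; rewrite word_ofK. Qed.

Lemma twin_cong_cat n (u v u' v' : seq 'I_n.-1) :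
  twin_cong u u' -> twin_cong v v' -> twin_cong (u ++ v) (u' ++ v').
Proof.
move=> uu' vv'; apply: (@twin_cong_trans _ _ (u' ++ v)).
  elim: uu' => {u u' v' vv'} [w | u w _ | u w z _ h1 _ h2 | x y j | x y j k jk].
  - exact: twin_cong_refl.
  - exact: twin_cong_sym.
  - exact: twin_cong_trans h1 h2.
  - by rewrite -!catA; apply: twin_cong_sq.
  - by rewrite -!catA; apply: twin_cong_comm.
elim: vv' => {u uu' v v'} [w | u w _ | u w z _ h1 _ h2 | x y j | x y j k jk].
- exact: twin_cong_refl.
- exact: twin_cong_sym.
- exact: twin_cong_trans h1 h2.
- by rewrite !(catA u'); apply: twin_cong_sq.
- by rewrite !(catA u'); apply: twin_cong_comm.
Qed.

Lemma twin_cong_rev n (u v : seq 'I_n.-1) :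
  twin_cong u v -> twin_cong (rev u) (rev v).
Proof.
elim=> {u v} [w | u w _ | u w z _ h1 _ h2 | x y j | x y j k jk].
- exact: twin_cong_refl.
- exact: twin_cong_sym.
- exact: twin_cong_trans h1 h2.
- by rewrite !rev_cat -catA; apply: twin_cong_sq.
- by rewrite !rev_cat -!catA; apply: twin_cong_comm; rewrite orbC.
Qed.

Lemma twin_cong_revl n (w : seq 'I_n.-1) : twin_cong (rev w ++ w) [::].
Proof.
elim: w => [|j w IHw]; first exact: twin_cong_refl.
rewrite rev_cons cat_rcons; apply: twin_cong_trans IHw.
exact: (twin_cong_sq (rev w) w j).
Qed.

Definition twin_mul n (u v : twin n) : twin n :=
  twin_of (word_of u ++ word_of v).
Definition twin_inv n (u : twin n) : twin n := twin_of (rev (word_of u)).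

Lemma twin_mul_of n (v w : seq 'I_n.-1) :
  twin_mul (twin_of v) (twin_of w) = twin_of (v ++ w).
Proof. by apply/twin_ofP; apply: twin_cong_cat; apply: word_of_cong. Qed.

Lemma twin_inv_of n (w : seq 'I_n.-1) : twin_inv (twin_of w) = twin_of (rev w).
Proof. by apply/twin_ofP; apply: twin_cong_rev; apply: word_of_cong. Qed.

Lemma twin_mulA n : associative (@twin_mul n).
Proof.
move=> u v w; rewrite -(word_ofK u) -(word_ofK v) -(word_ofK w).
by rewrite !twin_mul_of catA.
Qed.

Lemma twin_mul1 n : left_id (twin_of [::]) (@twin_mul n).
Proof. by move=> u; rewrite -(word_ofK u) twin_mul_of. Qed.

Lemma twin_mulr1 n : right_id (twin_of [::]) (@twin_mul n).
Proof. by move=> u; rewrite -(word_ofK u) twin_mul_of cats0. Qed.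

Lemma twin_mulV n : left_inverse (twin_of [::]) (@twin_inv n) (@twin_mul n).
Proof.
move=> u; rewrite -(word_ofK u) twin_inv_of twin_mul_of.
by apply/twin_ofP; apply: twin_cong_revl.
Qed.

Lemma twin_mulrV n : right_inverse (twin_of [::]) (@twin_inv n) (@twin_mul n).
Proof.
move=> u; rewrite -(word_ofK u) twin_inv_of twin_mul_of.
apply/twin_ofP; rewrite -{1}(revK (word_of u)); exact: twin_cong_revl.
Qed.

HB.instance Definition _ n := isGroup.Build (twin n)
  (@twin_mulA n) (@twin_mul1 n) (@twin_mulr1 n) (@twin_mulV n) (@twin_mulrV n).

Lemma twin_of_nil n : twin_of [::] = 1 :> twin n.
Proof. reflexivity. Qed.

Lemma twin_of_cat n (v w : seq 'I_n.-1) :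
  twin_of (v ++ w) = twin_of v * twin_of w.
Proof. by symmetry; apply: twin_mul_of. Qed.

(* The junk value is 1 when n <= j.+1. *)
Definition t n (j : nat) : twin n :=
  if insub j is Some k then twin_of [:: k] else 1.

Lemma tE n (j : 'I_n.-1) : t n j = twin_of [:: j].
Proof. by rewrite /t valK. Qed.

Lemma t_sq n j : t n j * t n j = 1.
Proof.
rewrite /t; case: insubP => [k _ _|_]; last by rewrite mulg1.
by rewrite -twin_of_cat; apply/twin_ofP; apply: (twin_cong_sq [::] [::] k).
Qed.

Lemma t_comm n j k : (j.+1 < k)%N -> t n j * t n k = t n k * t n j.
Proof.
move=> jk; rewrite /t; case: insubP => [j' _ vj|_]; last by rewrite mulg1 mul1g.
case: insubP => [k' _ vk|_]; last by rewrite mulg1 mul1g.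
rewrite -!twin_of_cat; apply/twin_ofP.
by apply: (twin_cong_comm [::] [::]); rewrite vj vk jk.
Qed.

Lemma twin_ofE n (w : seq 'I_n.-1) : twin_of w = \prod_(j <- w) t n j.
Proof.
elim: w => [|j w IHw]; first by rewrite big_nil.
by rewrite big_cons tE -IHw -twin_of_cat.
Qed.

Lemma twin_presentation n (gT : groupType) (f : 'I_n.-1 -> gT) :
    (forall j, f j * f j = 1) ->
    (forall j k : 'I_n.-1, (j.+1 < k)%N -> f j * f k = f k * f j) ->
  exists F : twin n -> gT,
    {morph F : u v / u * v} /\ forall j : 'I_n.-1, F (t n j) = f j.
Proof.
move=> f_sq f_comm; pose g w := \prod_(j <- w) f j.
have g_cong v w : twin_cong v w -> g v = g w.
  elim=> {v w} [//|//|u v w _ -> _ -> //|x y j|x y j k jk].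
    by rewrite /g !big_cat /= !big_cons big_nil mulg1 f_sq mul1g.
  rewrite /g !big_cat /= !big_cons !big_nil !mulg1.
  by case/orP: jk => /f_comm ->.
exists (fun u => g (word_of u)); split=> [u v | j].
  rewrite -{1}(word_ofK u) -{1}(word_ofK v) -twin_of_cat.
  by rewrite (g_cong _ _ (word_of_cong _)) /g big_cat.
by rewrite tE (g_cong _ _ (word_of_cong _)) /g big_seq1.
Qed.

Definition strandl n (j : 'I_n.-1) : 'I_n := widen_ord (leq_pred n) j.

Lemma strandr_proof n (j : 'I_n.-1) : (j.+1 < n)%N.
Proof. by case: n j => [[]//|[[]//|n]] j; rewrite ltnS. Qed.
Definition strandr n (j : 'I_n.-1) : 'I_n := Ordinal (strandr_proof j).

Definition cross n (j : 'I_n.-1) : 'S_n := tperm (strandl j) (strandr j).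

Lemma crossE n (j : 'I_n.-1) (i : 'I_n) :
  cross j i = (if i == j :> nat then j.+1 else
               if i == j.+1 :> nat then j : nat else i) :> nat.
Proof.
rewrite /cross; case: tpermP => [->|->|] /=; first by rewrite eqxx.
  by rewrite eqxx gtn_eqF.
by move=> /eqP; rewrite -val_eqE /= => /negPf-> /eqP; rewrite -val_eqE /= => /negPf->.
Qed.

(* Permutations compose left to right, (s * s') i = s' (s i), as stacked       *)
(* twins do.                                                                   *)
Definition nu_word n (w : seq 'I_n.-1) : 'S_n := \prod_(j <- w) cross j.

Lemma nu_word_cong n (v w : seq 'I_n.-1) :
  twin_cong v w -> nu_word v = nu_word w.
Proof.
elim=> {v w} [//|//|u v w _ -> _ -> //|x y j|x y j k jk]; rewrite /nu_word.
  by rewrite !big_cat /= !big_cons big_nil mulg1 tperm2 mul1g.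
rewrite !big_cat /= !big_cons !big_nil !mulg1; congr (_ * (_ * _)).
apply/permP=> i; apply: val_inj; rewrite !permM /= !crossE.
by do !case: eqP; move: jk; lia.
Qed.

Definition nu n (u : twin n) : 'S_n := nu_word (word_of u).

Lemma nu_of n (w : seq 'I_n.-1) : nu (twin_of w) = \prod_(j <- w) cross j.
Proof. exact/nu_word_cong/word_of_cong. Qed.

Lemma nuM n : {morph @nu n : u v / u * v}.
Proof.
move=> u v; rewrite -(word_ofK u) -(word_ofK v) -twin_of_cat !nu_of.
by rewrite big_cat.
Qed.

Lemma nu_t n (j : 'I_n.-1) : nu (t n j) = cross j.
Proof. by rewrite tE nu_of big_seq1. Qed.

Definition pure_twin n : {pred twin n} := [pred u | nu u == 1].
Arguments pure_twin n : clear implicits.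

Lemma pure_twin_group_closed n : group_closed (pure_twin n).
Proof.
have nu1 : nu (1 : twin n) = 1 by rewrite -twin_of_nil nu_of big_nil.
split=> [|u v]; rewrite !inE ?nu1 // => /eqP nu_u /eqP nu_v.
by rewrite -(inj_eq (mulIg (nu v))) -nuM divgK nu_u nu_v mul1g.
Qed.

Definition del_gen n (i j : nat) : twin n.-1 :=
  if (i < j)%N then t n.-1 j.-1
  else if (i <= j.+1)%N then 1
  else t n.-1 j.

(* Iterates d_i(t_j w) = d_i(t_j) d_(nu(t_j)(i)) (w). *)
Fixpoint del_word n (i : 'I_n) (w : seq 'I_n.-1) : twin n.-1 :=
  if w is j :: w' then del_gen n i j * del_word (cross j i) w' else 1.

Lemma del_word_cat n (i : 'I_n) (v w : seq 'I_n.-1) :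
  del_word i (v ++ w) = del_word i v * del_word (nu_word v i) w.
Proof.
elim: v i => [|j v IHv] i /=; first by rewrite mul1g /nu_word big_nil perm1.
by rewrite IHv mulgA /nu_word big_cons permM.
Qed.

Lemma del_gen_sq n (j : 'I_n.-1) (i : 'I_n) :
  del_gen n i j * del_gen n (cross j i) j = 1.
Proof.
rewrite crossE /del_gen; case: eqP => [->|/eqP ij].
  by rewrite ltnn leqnSn ltnNge leqnSn leqnn mul1g.
case: eqP => [->|/eqP ij1].
  by rewrite ltnn leqnSn ltnNge leqnSn leqnn mul1g.
by do 2![case: ifP => _; rewrite ?mul1g ?t_sq //].
Qed.

Lemma del_gen_comm n (j k : 'I_n.-1) (i : 'I_n) : (j.+1 < k)%N ->
  del_gen n i j * del_gen n (cross j i) k =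
  del_gen n i k * del_gen n (cross k i) j.
Proof.
move=> jk; rewrite !crossE /del_gen.
have tc a b : (a.+1 < b)%N -> t n.-1 a * t n.-1 b = t n.-1 b * t n.-1 a.
  exact: t_comm.
do ?[case: eqP => ? | case: ifP => ?]; rewrite ?mul1g ?mulg1 //; try lia;
  apply: tc; lia.
Qed.

Lemma del_word_cong n (i : 'I_n) (v w : seq 'I_n.-1) :
  twin_cong v w -> del_word i v = del_word i w.
Proof.
elim=> {v w} [//|//|u v w _ -> _ -> //|x y j|x y j k jk].
  rewrite !del_word_cat; congr (_ * _); rewrite /= mulg1 del_gen_sq mul1g.
  by rewrite /nu_word !big_cons big_nil mulg1 tperm2 perm1.
rewrite !del_word_cat; congr (_ * _); rewrite /= !mulg1; congr (_ * _).
  by case/orP: jk => /del_gen_comm ->.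
by have /nu_word_cong/= -> := twin_cong_comm [::] [::] jk.
Qed.

Definition d n (i : 'I_n) (u : twin n) : twin n.-1 := del_word i (word_of u).

Lemma d_of n (i : 'I_n) (w : seq 'I_n.-1) : d i (twin_of w) = del_word i w.
Proof. exact/del_word_cong/word_of_cong. Qed.

Lemma dM n (i : 'I_n) (u v : twin n) : d i (u * v) = d i u * d (nu u i) v.
Proof.
rewrite -(word_ofK u) -(word_ofK v) -twin_of_cat !d_of del_word_cat.
by rewrite nu_of.
Qed.

Lemma d_t n (i : 'I_n) (j : 'I_n.-1) :
  d i (t n j) = if (i < j)%N then t n.-1 j.-1
                else if (i <= j.+1)%N then 1
                else t n.-1 j.
Proof. by rewrite tE d_of /= mulg1. Qed.

Lemma nu_tE n (j : nat) (k : 'I_n) : (j.+1 < n)%N ->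
  nu (t n j) k = (if k == j :> nat then j.+1 else
                  if k == j.+1 :> nat then j else k : nat) :> nat.
Proof.
move=> jn; have jn' : (j < n.-1)%N by lia.
by rewrite -[j]/(nat_of_ord (Ordinal jn')) nu_t crossE.
Qed.

Lemma nu_del_gen n (j : 'I_n.-1) (i : 'I_n) (k : 'I_n.-1) :
  lift (cross j i) (nu (del_gen n i j) k) = cross j (lift i k).
Proof.
apply: val_inj; have nu1 : nu (1 : twin n.-1) = 1.
  by rewrite -twin_of_nil nu_of big_nil.
have := ltn_ord i; have := ltn_ord j; have := ltn_ord k.
rewrite /= !crossE /= /bump /del_gen => kn jn lt_in.
do ![case: ifP => ?]; rewrite ?nu1 ?perm1 ?nu_tE; try lia;
  do ?[case: ifP => ?]; lia.
Qed.

Lemma nu_d n (i : 'I_n) (u : twin n) (k : 'I_n.-1) :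
  lift (nu u i) (nu (d i u) k) = nu u (lift i k).
Proof.
rewrite -(word_ofK u) d_of; elim: (word_of u) i k => [|j w IHw] i k.
  by rewrite twin_of_nil -[del_word _ _]/(1 : twin _) -!twin_of_nil !nu_of
             !big_nil !perm1.
rewrite /= nuM -[j :: w]cat1s twin_of_cat nuM !permM -tE nu_t.
by rewrite IHw nu_del_gen.
Qed.

Lemma d_pure n (i : 'I_n) (u : twin n) :
  u \in pure_twin n -> d i u \in pure_twin n.-1.
Proof.
rewrite !inE => /eqP nu_u; apply/eqP/permP=> k.
by have := nu_d i u k; rewrite nu_u !perm1 => /lift_inj.
Qed.

(* Main.v *)
Require Import Defs.
From mathcomp Require Import all_boot all_fingroup.
From mathcomp Require Import zify.

Set Implicit Arguments.
Unset Strict Implicit.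
Unset Printing Implicit Defensive.

Local Open Scope group_scope.

(** Deleting two strands gives the same twin in either order, so the maps
    [d i] satisfy the face identities [d_d]. Applied to [w] with all faces equal
    to [u], they say that all faces of [u] agree: this is the necessity of the
    condition.

    Conversely, the constant family [u, ..., u] is then compatible with the face
    identities, like the boundary of a simplex, and it has to be filled. For
    pure twins the faces are group homomorphisms, and the filling follows
    Moore's proof that simplicial groups are Kan complexes: correct the faces of
    a candidate [w] one after the other, multiplying [w] by a pure twin whose i-th
    face is the error [y] and whose earlier faces are trivial ([insert_strand],
    [pure_filling]). There is no missing face here, because a strand can be
    added on the far right of any twin without crossing anything, which plays
    the role of an extra degeneracy. To insert a strand at position [i] instead,
    conjugate by a twin [g] in which strand [i] crosses its neighbours one after
    the other until it reaches the right end ([move_strand_right]): deleting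
    that strand from [g] leaves the identity, so the i-th face of
    [g * (y plus a strand) * g^-1] is [y].

    For twins that need not be pure, the same filling works after division by
    one twin [w0] whose faces have the same permutations as the prescribed ones
    ([filling]). If all faces of [u] agree, then so do their permutations, and
    this forces [nu u] to be monotone: increasing, hence the identity, or
    decreasing, hence the reversal. In the first case [w0] is [1], in the second
    it is any twin that reverses the order of the strands ([base_twin]). *)

(** * Elementary properties of twins, permutations and faces *)

Lemma morphism1 (gT hT : groupType) (f : gT -> hT) :
  {morph f : u v / u * v} -> f 1 = 1.
Proof. by move=> fM; apply: (mulgI (f 1)); rewrite -fM !mulg1. Qed.

Lemma twin_ind n (P : twin n -> Prop) :
  P 1 -> (forall (j : 'I_n.-1) u, P u -> P (t n j * u)) -> forall u, P u.
Proof.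
move=> P1 Pt u; rewrite -(word_ofK u).
elim: (word_of u) => [|j w IHw]; first by rewrite twin_of_nil.
by rewrite -[j :: w]cat1s twin_of_cat -tE; apply: Pt.
Qed.

Lemma nu1 n : nu (1 : twin n) = 1.
Proof. by rewrite -twin_of_nil nu_of big_nil. Qed.

Lemma nuV n (u : twin n) : nu u^-1 = (nu u)^-1.
Proof. by apply: (mulgI (nu u)); rewrite -nuM !mulgV nu1. Qed.

Lemma d1 n (i : 'I_n) : d i 1 = 1.
Proof. by rewrite -twin_of_nil d_of. Qed.

(** The index moves because faces of non-pure twins are only crossed
    homomorphisms. *)
Lemma dV n (i : 'I_n) (u : twin n) : d (nu u i) u^-1 = (d i u)^-1.
Proof. by apply: (mulgI (d i u)); rewrite -dM !mulgV d1. Qed.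

Lemma t_default n j : (n <= j.+1)%N -> t n j = 1.
Proof. by move=> nj; rewrite /t insubF //; lia. Qed.

Lemma d_tE n (i : 'I_n) j : d i (t n j) = del_gen n i j.
Proof.
have lt_in := ltn_ord i.
have [jn|nj] := ltnP j n.-1; first by rewrite -[j]/(val (Ordinal jn)) d_t.
rewrite t_default ?d1 /del_gen; last by lia.
by do 2?[case: ifP => ?] => //; rewrite t_default //; lia.
Qed.

(** The face identities, with both orders of deletion on an equal footing: [a]
    is what strand [j] is called once [i] is gone, and [b] is what strand [i] is
    called once [j] is gone. This symmetric form is stable under following the
    strands through a crossing, so that induction on the word applies. *)
Lemma d_d n (i j : 'I_n) (a b : 'I_n.-1) (w : twin n) :
  lift i a = j -> lift j b = i -> d a (d i w) = d b (d j w).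
Proof.
elim/twin_ind: w i j a b => [|k w IHw] i j a b ia jb; first by rewrite !d1.
rewrite !(dM _ (t n k)) !dM; congr (_ * _).
  have lt_kn := ltn_ord k; have lt_an := ltn_ord a; have lt_bn := ltn_ord b.
  move: (congr1 val ia) (congr1 val jb); rewrite !d_tE /= /bump => {}ia {}jb.
  rewrite /del_gen.
  do 12?[case: ifP => ?|rewrite d1|rewrite d_tE /del_gen] => //; try lia;
    congr (t _ _); lia.
by apply: IHw; rewrite !d_tE nu_t nu_del_gen ?ia ?jb.
Qed.

(** * Adding a strand on the right and moving it into position *)

Lemma add_right_strand m : exists e : twin m -> twin m.+1,
  {morph e : u v / u * v} /\ forall j : 'I_m.-1, e (t m j) = t m.+1 j.
Proof.
apply: (@twin_presentation m (twin m.+1) (fun j => t m.+1 j)) => [j|j k].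
  exact: t_sq.
exact: t_comm.
Qed.

Lemma d_add_max m (e : twin m -> twin m.+1) :
    {morph e : u v / u * v} -> (forall j : 'I_m.-1, e (t m j) = t m.+1 j) ->
  forall u : twin m, nu (e u) ord_max = ord_max /\ d ord_max (e u) = u.
Proof.
move=> eM e_t.
have e1 := morphism1 eM.
elim/twin_ind=> [|j u [IHnu IHd]]; first by rewrite e1 nu1 perm1 d1.
have lt_jm := ltn_ord j.
have fix_max : nu (t m.+1 j) ord_max = ord_max.
  by apply: ord_inj; rewrite nu_tE /=; do ?[case: eqP]; lia.
rewrite eM e_t nuM dM permM fix_max IHnu IHd d_tE; split=> //.
by rewrite /del_gen /=; do ?[case: ifP => ?] => //; lia.
Qed.

(** Consequently a trivial face stays trivial when a strand is added on the
    right. *)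
Lemma d_add_lift m (e : twin m.+1 -> twin m.+2) (e' : twin m -> twin m.+1) :
    {morph e : u v / u * v} ->
    (forall j : 'I_m.+1.-1, e (t m.+1 j) = t m.+2 j) ->
    {morph e' : u v / u * v} -> (forall j : 'I_m.-1, e' (t m j) = t m.+1 j) ->
  forall (u : twin m.+1) (k : 'I_m.+1), d (lift ord_max k) (e u) = e' (d k u).
Proof.
move=> eM e_t e'M e'_t.
have e1 := morphism1 eM.
have e'1 := morphism1 e'M.
elim/twin_ind=> [|j u IHu] k; first by rewrite e1 !d1.
have lt_jm : j < m := ltn_ord j.
have lt_km := ltn_ord k.
have nu_lift : nu (t m.+2 j) (lift ord_max k) = lift ord_max (nu (t m.+1 j) k).
  apply: ord_inj; rewrite lift_max !nu_tE ?lift_max //.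
  by rewrite /bump; do ?[case: eqP]; lia.
rewrite eM e_t !dM nu_lift IHu e'M; congr (_ * _).
rewrite !d_tE /del_gen lift_max.
have e't' l : l < m.-1 -> e' (t m l) = t m.+1 l.
  by move=> lm; rewrite -[l]/(val (Ordinal lm)) e'_t.
by do ?[case: ifP => ?]; rewrite ?e't' //; lia.
Qed.

(** The twin $t_i t_{i+1} \cdots t_{m-1}$, where every crossing involves the
    strand that starts at position [i]. *)
Lemma move_strand_right m (i : 'I_m.+1) :
  exists g : twin m.+1, nu g i = ord_max /\ d i g = 1.
Proof.
have [c] := ubnP (m - i); elim: c i => // c IHc i; rewrite ltnS => le_c.
have lt_im := ltn_ord i.
have [lt_i|ge_i] := ltnP i m; last first.
  by exists 1; rewrite nu1 perm1 d1; split=> //; apply: val_inj => /=; lia.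
have [g [nu_g d_g]] := IHc (Ordinal (lt_i : i.+1 < m.+1)) ltac:(move=> /=; lia).
have nu_ti : nu (t m.+1 i) i = Ordinal (lt_i : i.+1 < m.+1).
  by apply: ord_inj; rewrite nu_tE //= eqxx.
exists (t m.+1 i * g); rewrite nuM permM dM nu_ti nu_g d_g; split=> //.
by rewrite mulg1 d_tE /del_gen ltnn leqnSn.
Qed.

(** The correction term of the filling argument: a pure twin with i-th face [y]
    that has a trivial face wherever [y] has one. It is the conjugate, by a twin
    that moves strand [i] to the right end, of [y] with a strand added on the
    right. *)
Lemma insert_strand m (i : 'I_m.+2) (y : twin m.+1) : y \in pure_twin m.+1 ->
  exists2 w : twin m.+2, w \in pure_twin m.+2 &
    d i w = y /\ forall k : 'I_m.+1, d k y = 1 -> d (lift i k) w = 1.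
Proof.
rewrite inE => /eqP nu_y.
have [e [eM e_t]] := add_right_strand m.+1.
have [e' [e'M e'_t]] := add_right_strand m.
have e'1 := morphism1 e'M.
have [nu_e d_e] := d_add_max eM e_t y.
have [g [nu_g d_g]] := move_strand_right i.
have nu_ey : nu (e y) = 1.
  apply/permP=> j; rewrite perm1; have [k ->|->//] := unliftP ord_max j.
  by rewrite -nu_d nu_e d_e nu_y perm1.
(* Without strand i, the twin g is trivial, so g keeps the other strands in
   their order. *)
have nu_gl k : nu g (lift i k) = lift ord_max k.
  by rewrite -nu_d nu_g d_g nu1 perm1.
exists (g * e y * g^-1).
  by rewrite inE !nuM nuV nu_ey mulg1 mulgV.
have dgey j : d j (g * e y * g^-1) = d j g * d (nu g j) (e y) * (d j g)^-1.
  by rewrite !dM nuM permM nu_ey perm1 dV.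
split=> [|k dk]; first by rewrite dgey d_g mul1g nu_g d_e invg1 mulg1.
by rewrite dgey nu_gl (d_add_lift eM e_t e'M e'_t) dk e'1 mulg1 mulgV.
Qed.

(** * Filling compatible families of faces *)

(** If the faces of [w] before the k-th are right, the face identities make the
    corresponding faces of the error [(d k w)^-1 * x k] trivial; inserting a
    strand in it gives a factor that repairs the k-th face and leaves the
    earlier ones alone. *)
Lemma pure_filling m (x : 'I_m.+2 -> twin m.+1) :
    (forall i, x i \in pure_twin m.+1) ->
    (forall (i j : 'I_m.+2) (a b : 'I_m.+1), lift i a = j -> lift j b = i ->
       d a (x i) = d b (x j)) ->
  exists2 w : twin m.+2, w \in pure_twin m.+2 & forall i, d i w = x i.
Proof.
move=> x_pure x_compat.
suff fill k : k <= m.+2 ->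
    exists2 w : twin m.+2, w \in pure_twin m.+2 &
      forall i : 'I_m.+2, i < k -> d i w = x i.
  by have [//|w w_pure d_w] := fill m.+2; exists w => // i; apply: d_w.
elim: k => [|k IHk] lt_k; first by exists 1; rewrite // inE nu1.
have [w w_pure d_w] := IHk (ltnW lt_k).
pose i := Ordinal lt_k; pose y := (d i w)^-1 * x i.
have dw_pure := d_pure i w_pure.
move: w_pure dw_pure (x_pure i).
rewrite !inE => /eqP nu_w /eqP nu_dw /eqP nu_x.
have [|v v_pure [d_iv d_v]] := @insert_strand m i y.
  by rewrite inE nuM nuV nu_dw nu_x mulg1 invg1.
exists (w * v); first by move: v_pure; rewrite !inE nuM nu_w mul1g.
move=> j lt_jk; rewrite dM nu_w perm1.
have [a jE|->] := unliftP i j; last by rewrite d_iv /y mulKVg.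
have lt_ja : j < k.
  rewrite ltn_neqAle -ltnS lt_jk andbT; apply/eqP=> jk.
  by have := neq_lift i a; rewrite -jE -val_eqE /= jk eqxx.
have [b ib|ij] := unliftP j i; last by move: lt_ja; rewrite -ij /= ltnn.
(* The error y has trivial face a, by compatibility of both d and x. *)
rewrite jE d_v -?jE ?d_w ?mulg1 // /y dM nuV nu_dw invg1 perm1.
have := dV a (d i w); rewrite nu_dw perm1 => ->.
rewrite (d_d w (esym jE) (esym ib)) d_w //.
by rewrite (x_compat _ _ _ _ (esym jE) (esym ib)) mulVg.
Qed.

(** Compatible families whose permutations are those of the faces of some [w0]:
    the quotients [x i * (d i w0)^-1] are pure and still compatible, since both
    families follow the same permutations. *)
Lemma filling m (w0 : twin m.+2) (x : 'I_m.+2 -> twin m.+1) :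
    (forall i, nu (x i) = nu (d i w0)) ->
    (forall (i j : 'I_m.+2) (a b : 'I_m.+1), lift i a = j -> lift j b = i ->
       d a (x i) = d b (x j)) ->
  exists w : twin m.+2, forall i, d i w = x i.
Proof.
move=> nu_x x_compat.
pose y i := x i * (d i w0)^-1.
have d_y i a : d a (y i) = d a (x i) * (d a (d i w0))^-1.
  by rewrite /y dM nu_x dV.
have [i|i j a b ia jb|v v_pure d_v] := @pure_filling m y.
- by rewrite inE nuM nuV nu_x mulgV.
- by rewrite !d_y (x_compat _ _ _ _ ia jb) (d_d w0 ia jb).
exists (v * w0) => i; move: v_pure; rewrite inE => /eqP nu_v.
by rewrite dM nu_v perm1 d_v mulgKV.
Qed.

(** * Permutations of the twins all of whose faces agree *)

(** The first strand is moved to the right end, above a reversing twin of the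
    remaining strands. *)
Lemma reversing_twin m : exists w : twin m, forall i, nu w i = rev_ord i.
Proof.
elim: m => [|m [w nu_w]]; first by exists 1 => -[].
have [e [eM e_t]] := add_right_strand m.
have [nu_e d_e] := d_add_max eM e_t w.
have [g [nu_g d_g]] := move_strand_right (ord0 : 'I_m.+1).
exists (g * e w) => i; rewrite nuM permM.
have [k ->|->] := unliftP ord0 i.
  rewrite -nu_d nu_g d_g nu1 perm1 -nu_d nu_e d_e nu_w.
  by apply: ord_inj; rewrite lift_max /= /bump; lia.
by rewrite nu_g nu_e; apply: val_inj; rewrite /= subn1.
Qed.

Lemma increasing_id m (f : 'I_m -> 'I_m) :
  (forall i j : 'I_m, i < j -> f i < f j) -> f =1 id.
Proof.
have ge_id (h : 'I_m -> 'I_m) :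
    (forall i j : 'I_m, i < j -> h i < h j) -> forall i : 'I_m, i <= h i.
  move=> h_incr i; have [c] := ubnP i; elim: c i => // c IHc i lt_ic.
  have [->//|i_gt0] := posnP i.
  have lt_i1 : i.-1 < m by have := ltn_ord i; lia.
  have := h_incr (Ordinal lt_i1) i; have := IHc (Ordinal lt_i1).
  by move=> /=; lia.
move=> f_incr i; apply: ord_inj; apply/eqP.
rewrite eqn_leq (ge_id _ f_incr) andbT.
(* The reversal turns the lower bound for its conjugate of f into the upper
   bound for f. *)
have := ge_id (fun k => rev_ord (f (rev_ord k))) _ (rev_ord i).
rewrite rev_ordK /= => h; have := ltn_ord i; have := ltn_ord (f i).
suff: m - i.+1 <= m - (f i).+1 by lia.
apply: h => j k jk; have := f_incr (rev_ord k) (rev_ord j).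
have := ltn_ord (f (rev_ord j)); have := ltn_ord k; rewrite /=; lia.
Qed.

(** Deleting strand [k] does not change whether two other strands are inverted,
    it only renumbers them. If all faces agree, the pairs of strands called
    [(a, b)] after any deletion are inverted or not simultaneously. As [k]
    varies, these are the pairs [(a, b)], [(a, b+1)] and [(a+1, b+1)], and such
    steps connect every pair to [(0, 1)]. *)
Lemma monotone_of_equal_faces m (u : twin m.+2) :
    (forall i j : 'I_m.+2, d i u = d j u) ->
  forall a b : 'I_m.+2, a < b ->
  (nu u a < nu u b) = (nu u ord0 < nu u (lift ord0 ord0)).
Proof.
move=> d_u.
have ltE (i : 'I_m.+2) (a b : 'I_m.+1) :
    (nu u (lift i a) < nu u (lift i b)) = (nu (d ord0 u) a < nu (d ord0 u) b).
  rewrite -!nu_d (d_u i ord0) /= /bump.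
  by do 2!case: leqP; lia.
(* On plain numbers, the three pairs are obtained with k = b+1, k = b, k = a. *)
pose F a b := nu u (inord a) < nu u (inord b).
have FE (i a b : nat) : i < m.+2 -> a < m.+1 -> b < m.+1 ->
    F (bump i a) (bump i b) =
    (nu (d ord0 u) (inord a) < nu (d ord0 u) (inord b)).
  move=> lt_i lt_a lt_b; rewrite -(ltE (inord i)) /F.
  by congr (nu u _ < nu u _); apply: val_inj; rewrite /= !inordK // /bump; lia.
have Fr a b : a < b -> b < m.+1 -> F a b.+1 = F a b.
  move=> ab bm.
  have -> : F a b.+1 = F (bump b a) (bump b b) by congr F; rewrite /bump; lia.
  have -> : F a b = F (bump b.+1 a) (bump b.+1 b).
    by congr F; rewrite /bump; lia.
  by rewrite !FE; lia.
have Fs a : a.+1 < m.+1 -> F a.+1 a.+2 = F a a.+1.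
  move=> am.
  have -> : F a.+1 a.+2 = F (bump a a) (bump a a.+1).
    by congr F; rewrite /bump; lia.
  have -> : F a a.+1 = F (bump a.+2 a) (bump a.+2 a.+1).
    by congr F; rewrite /bump; lia.
  by rewrite !FE; lia.
have F1 a : a.+1 < m.+2 -> F a a.+1 = F 0%N 1%N.
  by elim: a => [//|a IHa] am; rewrite Fs ?IHa //; lia.
have Fc c a : a.+1 + c < m.+2 -> F a (a.+1 + c) = F 0%N 1%N.
  elim: c => [|c IHc] am; first by rewrite addn0 F1 //; lia.
  by rewrite addnS Fr ?IHc //; lia.
move=> a b ab.
have := Fc (b - a.+1) a; rewrite subnKC // => /(_ (ltn_ord b)).
rewrite /F !inord_val => ->.
by congr (nu u _ < nu u _); apply: val_inj; rewrite /= inordK.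
Qed.

Lemma base_twin m (u : twin m.+2) :
    (forall i j : 'I_m.+2, d i u = d j u) ->
  exists w0 : twin m.+3, forall i, nu (d i w0) = nu u.
Proof.
move=> d_u; have mono := monotone_of_equal_faces d_u.
have [up|down] := boolP (nu u ord0 < nu u (lift ord0 ord0)).
  exists 1 => i; rewrite d1 nu1; apply/permP=> k; rewrite perm1.
  by rewrite (@increasing_id _ (nu u)) // => a b /mono->.
have [w nu_w] := reversing_twin m.+3.
have nu_u k : nu u k = rev_ord k.
  rewrite -[LHS]rev_ordK; congr rev_ord.
  apply: (@increasing_id _ (fun k => rev_ord (nu u k))) => a b ab.
  have ne : nu u a != nu u b by rewrite (inj_eq perm_inj) -val_eqE ltn_eqF.
  have := mono _ _ ab; rewrite (negPf down) => /negbT.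
  move: ne; rewrite -val_eqE /=.
  by have := ltn_ord (nu u a); have := ltn_ord (nu u b); lia.
exists w => i; apply/permP=> k; rewrite nu_u.
have := nu_d i w k; rewrite !nu_w => /(congr1 val).
move=> /= h; apply: val_inj; move: h => /=; rewrite /bump.
have := ltn_ord (nu (d i w) k); have := ltn_ord i; have := ltn_ord k.
by move: (nat_of_ord (nu _ _)) => /= c; do 2!case: leqP; lia.
Qed.

Theorem theorem4p10 (n : nat) (hn : (3 <= n)%N) :
  (forall u : twin n.-1, u \in pure_twin n.-1 ->
     (exists2 w : twin n, w \in pure_twin n & forall i : 'I_n, d i w = u)
     <-> (forall i j : 'I_n.-1, d i u = d j u)) /\
  (forall u : twin n.-1,
     (exists w : twin n, forall i : 'I_n, d i w = u)
     <-> (forall i j : 'I_n.-1, d i u = d j u)).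
Proof.
case: n hn => [|[|[|m]]] // _.
have faces_eq (u : twin m.+2) (w : twin m.+3) :
    (forall i, d i w = u) -> forall i j : 'I_m.+2, d i u = d j u.
  move=> d_w.
  suff d_u0 i : d i u = d ord0 u by move=> i j; rewrite !d_u0.
  have := @d_d m.+3 (lift ord0 i) ord0 ord0 i w.
  rewrite !d_w => -> //; exact: val_inj.
split=> [u u_pure | u]; split.
- by case=> w _; apply: faces_eq.
- by move=> d_u; apply: (@pure_filling m.+1 (fun=> u)).
- by case=> w; apply: faces_eq.
move=> d_u; have [w0 nu_w0] := base_twin d_u.
by apply: (@filling m.+1 w0 (fun=> u)).
Qed.
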